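(* Let $S$ be a semigroup and $\sigma:S\to S$ an involutive automorphism. The solutions $f,g,h:S\to\mathbb{C}$ of the functional equation $$f(x\sigma(y))=f(x)g(y)+g(x)f(y)+h(x)h(y),\qquad x,y\in S,$$ such that $h^{e}$ and $f^{e}$ are linearly dependent and $f^{e}(S^{2})\neq\{0\}$ are exactly the triples of one of the following forms (A)-(F). Here $m,\chi,\chi_{1},\chi_{2}:S\to\mathbb{C}$ are multiplicative functions with $\chi_{1}\neq\chi_{2}$; $k:S\to\mathbb{C}$ is $0$-additive with $k^{*}=-k$; $\varphi:S\to\mathbb{C}$ is a non-zero $\chi$-additive function (non-zero $0$-additive in part (F)); $\psi:S\to\mathbb{C}$ is of type $(\chi,\varphi)$-cosine-sine (of type $(0,\varphi)$-cosine-sine in part (F)); and $\lambda,\mu,\eta\in\mathbb{C}$, $\rho,c\in\mathbb{C}\setminus\{0\}$ are constants, where $\lambda^{2}-2\mu\neq0$ and $\rho^{2}=-\frac{1}{4(\lambda^{2}-2\mu)}$ (the constants $\mu$, $\rho$ and $\eta$ occur only in part (A)). (A) $$f=\frac{1}{2(\lambda^{2}-2\mu)}(m+m^{*})+k,\qquad g=-\frac{\mu}{2(\lambda^{2}-2\mu)}(m+m^{*})+\lambda\rho(m-m^{*})-\frac{\eta^{2}}{2}k,$$ $$h=\frac{\lambda}{2(\lambda^{2}-2\mu)}(m+m^{*})-\rho(m-m^{*})+\eta k,$$ where either (i) $m=m^{*}\neq0$, and ($\eta^{2}-2\lambda\eta+2\mu=0$ and $\eta\neq0$) or ($\eta=\mu=0$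 and $\lambda\neq0$); or (ii) $m\neq m^{*}$ and $k=0$. (B) $$f=\frac{\chi_{1}-\chi_{2}}{2c},\quad g=\frac{(2c-\lambda^{2})\chi_{1}+(2c+\lambda^{2})\chi_{2}}{4c},\quad h=\frac{\lambda(\chi_{1}-\chi_{2})}{2c},$$ such that $\chi_{1}^{*}=\chi_{1}$ and $\chi_{2}^{*}=\chi_{2}$. (C) $$f=\varphi,\quad g=\chi-\frac{\lambda^{2}}{2}\varphi,\quad h=\lambda\varphi,$$ such that $\chi\neq0$, $\chi^{*}=\chi$ and $\varphi^{*}=\varphi$. (D) $$\begin{pmatrix} f\\ g\\ h\end{pmatrix}=\begin{pmatrix}1&0&0\\ -\frac{\lambda^{2}}{2}&1&i\lambda\\ \lambda&0&-i\end{pmatrix}\begin{pmatrix}\psi\\ \chi\\ \varphi\end{pmatrix}$$ such that $\psi^{*}=\psi$, $\chi^{*}=\chi$, $\varphi^{*}=-\varphi$ and $\varphi\neq0$. (E) $$\begin{pmatrix} f\\ g\\ h\end{pmatrix}=\begin{pmatrix}-2c^{2}&4c^{2}&0\\ \frac{1+4\lambda^{2}c^{2}}{4}&\frac{1-4\lambda^{2}c^{2}}{2}&-\lambda c\\ -2\lambda c^{2}&4\lambda c^{2}&c\end{pmatrix}\begin{pmatrix}\chi_{1}+\chi_{1}^{*}\\ \chi\\ \chi_{1}-\chi_{1}^{*}\end{pmatrix}$$ such that $\chi^{*}=\chi$, $\chi\neq\chi_{1}$ and $\chi_{1}^{*}\neq\chi_{1}$. (F) $$\begin{pmatrix} f\\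 g\\ h\end{pmatrix}=\begin{pmatrix}1&0&1\\ -\frac{\lambda^{2}}{2}&-\lambda i&-\frac{\lambda^{2}}{2}\\ \lambda&i&\lambda\end{pmatrix}\begin{pmatrix}\psi\\ \varphi\\ k\end{pmatrix},$$ where $\psi$ is of type $(0,\varphi)$-cosine-sine, $\psi^{*}=\psi$ and $\varphi^{*}=-\varphi$.
   Context: $S$ is a semigroup (a set with an associative composition), and $\sigma:S\to S$ is an automorphism with $\sigma(\sigma(x))=x$ for all $x\in S$. $S^{2}:=\{xy\mid x,y\in S\}$. For $F:S\to\mathbb{C}$, $F^{*}:=F\circ\sigma$ and $F^{e}:=\frac{F+F^{*}}{2}$ is the even part of $F$. A function $\chi:S\to\mathbb{C}$ is multiplicative if $\chi(xy)=\chi(x)\chi(y)$ for all $x,y\in S$ (the zero function is allowed). For $\chi$ multiplicative, $\varphi:S\to\mathbb{C}$ is $\chi$-additive if $\varphi(xy)=\varphi(x)\chi(y)+\chi(x)\varphi(y)$ for all $x,y\in S$; in particular $\varphi$ is $0$-additive iff $\varphi=0$ on $S^{2}$. For $\chi$ multiplicative and $\varphi$ $\chi$-additive, $\psi:S\to\mathbb{C}$ is of type $(\chi,\varphi)$-cosine-sine if $\psi(xy)=\psi(x)\chi(y)+\chi(x)\psi(y)+\varphi(x)\varphi(y)$ for all $x,y\in S$. Here $i$ in the matrices denotes the imaginary unit. *)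

(* Defs.v *)
From mathcomp Require Import all_boot all_order all_algebra.
From mathcomp Require Import reals complex.

Set Implicit Arguments.
Unset Strict Implicit.
Unset Printing Implicit Defensive.

Import GRing.Theory Num.Theory.
Local Open Scope ring_scope.
Local Open Scope complex_scope.

Section Defs.
Variables (R : realType) (S : semigroupType).

(* Products in [S] are written [(x * y)%g]; all other products are in [R[i]]. *)
Implicit Types (F f g h m k chi phi psi : S -> R[i]) (sigma : S -> S).

Definition zero_fun : S -> R[i] := fun=> 0.

Definition star sigma F : S -> R[i] := fun x => F (sigma x).

Definition even_part sigma F : S -> R[i] :=
  fun x => (F x + star sigma F x) / 2.

Definition is_even sigma F : Prop := star sigma F =1 F.

Definition is_odd sigma F : Prop := forall x, star sigma F x = - F x.

Definition lin_dependent f g : Prop :=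
  exists a b : R[i],
    (a, b) <> (0, 0) /\ forall x, a * f x + b * g x = 0.

Definition nonzero_on_products F : Prop := exists x y : S, F (x * y)%g <> 0.

(* No nontriviality is required: the zero function is multiplicative. *)
Definition multiplicative_fun chi : Prop :=
  forall x y, chi (x * y)%g = chi x * chi y.

Definition additive_wrt chi phi : Prop :=
  forall x y, phi (x * y)%g = phi x * chi y + chi x * phi y.

Definition cosine_sine_type chi phi psi : Prop :=
  forall x y,
    psi (x * y)%g = psi x * chi y + chi x * psi y + phi x * phi y.

Definition solves sigma f g h : Prop :=
  forall x y, f (x * sigma y)%g = f x * g y + g x * f y + h x * h y.

Definition form_A sigma f g h : Prop :=
  exists (m k : S -> R[i]) (lambda mu eta rho : R[i]),
    let d := lambda ^+ 2 - 2 * mu in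
    let ms := star sigma m in
    [/\ multiplicative_fun m,
        additive_wrt zero_fun k /\ is_odd sigma k,
        [/\ d <> 0, rho <> 0 & rho ^+ 2 = - (1 / (4 * d))],
        [/\ forall x, f x = 1 / (2 * d) * (m x + ms x) + k x,
            forall x, g x = - (mu / (2 * d)) * (m x + ms x)
                            + lambda * rho * (m x - ms x)
                            - eta ^+ 2 / 2 * k x
          & forall x, h x = lambda / (2 * d) * (m x + ms x)
                            - rho * (m x - ms x) + eta * k x]
      & [/\ m =1 ms, ~ (m =1 zero_fun)
          & (eta ^+ 2 - 2 * lambda * eta + 2 * mu = 0 /\ eta <> 0)
            \/ [/\ eta = 0, mu = 0 & lambda <> 0]]
        \/ (~ (m =1 ms) /\ k =1 zero_fun)].

Definition form_B sigma f g h : Prop :=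
  exists (chi1 chi2 : S -> R[i]) (lambda c : R[i]),
    [/\ [/\ multiplicative_fun chi1, multiplicative_fun chi2
          & ~ (chi1 =1 chi2)],
        c <> 0,
        is_even sigma chi1 /\ is_even sigma chi2
      & [/\ forall x, f x = (chi1 x - chi2 x) / (2 * c),
            forall x, g x = ((2 * c - lambda ^+ 2) * chi1 x
                             + (2 * c + lambda ^+ 2) * chi2 x) / (4 * c)
          & forall x, h x = lambda * (chi1 x - chi2 x) / (2 * c)]].

Definition form_C sigma f g h : Prop :=
  exists (chi phi : S -> R[i]) (lambda : R[i]),
    [/\ multiplicative_fun chi /\ ~ (chi =1 zero_fun),
        additive_wrt chi phi /\ ~ (phi =1 zero_fun),
        is_even sigma chi /\ is_even sigma phi
      & [/\ forall x, f x = phi x,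
            forall x, g x = chi x - lambda ^+ 2 / 2 * phi x
          & forall x, h x = lambda * phi x]].

(* In forms D, E and F the 3x3 matrix-vector products are written out
   row by row. *)
Definition form_D sigma f g h : Prop :=
  exists (chi phi psi : S -> R[i]) (lambda : R[i]),
    [/\ multiplicative_fun chi,
        additive_wrt chi phi /\ ~ (phi =1 zero_fun),
        cosine_sine_type chi phi psi,
        [/\ is_even sigma psi, is_even sigma chi & is_odd sigma phi]
      & [/\ forall x, f x = psi x,
            forall x, g x = - (lambda ^+ 2 / 2) * psi x + chi x
                            + 'i * lambda * phi x
          & forall x, h x = lambda * psi x - 'i * phi x]].

Definition form_E sigma f g h : Prop :=
  exists (chi chi1 : S -> R[i]) (lambda c : R[i]),
    let chi1s := star sigma chi1 in
    [/\ multiplicative_fun chi /\ multiplicative_fun chi1,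
        c <> 0,
        [/\ is_even sigma chi, ~ (chi =1 chi1) & ~ (chi1s =1 chi1)]
      & [/\ forall x, f x = - (2 * c ^+ 2) * (chi1 x + chi1s x)
                            + 4 * c ^+ 2 * chi x,
            forall x, g x = (1 + 4 * lambda ^+ 2 * c ^+ 2) / 4
                              * (chi1 x + chi1s x)
                            + (1 - 4 * lambda ^+ 2 * c ^+ 2) / 2 * chi x
                            - lambda * c * (chi1 x - chi1s x)
          & forall x, h x = - (2 * lambda * c ^+ 2) * (chi1 x + chi1s x)
                            + 4 * lambda * c ^+ 2 * chi x
                            + c * (chi1 x - chi1s x)]].

Definition form_F sigma f g h : Prop :=
  exists (phi psi k : S -> R[i]) (lambda : R[i]),
    [/\ additive_wrt zero_fun phi /\ ~ (phi =1 zero_fun),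
        cosine_sine_type zero_fun phi psi,
        additive_wrt zero_fun k /\ is_odd sigma k,
        is_even sigma psi /\ is_odd sigma phi
      & [/\ forall x, f x = psi x + k x,
            forall x, g x = - (lambda ^+ 2 / 2) * psi x
                            - lambda * 'i * phi x
                            - lambda ^+ 2 / 2 * k x
          & forall x, h x = lambda * psi x + 'i * phi x + lambda * k x]].

End Defs.

(* Main.v *)
Require Import Defs.
From mathcomp Require Import all_boot all_order all_algebra.
From mathcomp Require Import reals complex boolp ring.

Set Implicit Arguments.
Unset Strict Implicit.
Unset Printing Implicit Defensive.

Import GRing.Theory Num.Theory.
Local Open Scope ring_scope.

(** Put [H := h - l f], where [l] is the constant with [h^e = l f^e], and
    [G := g + l^2/2 f + l H].  The right-hand side of the equation is the same
    bilinear expression in [(f, G, H)] as in [(f, g, h)], and [H] is odd.  So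
    every case is the case [l = 0], and the constant that the families carry
    only records this shift ([solves_shift]).

    Write [u], [k] for the even and odd parts of [f].  Splitting the equation
    itself into its even and odd parts gives formulas for [u (x y)] and
    [k (x y)] ([even_equation], [odd_equation]).  The second one is
    antisymmetric in [x] and [y], so [k (x y) = - k (y x)]; applied three times
    around a product of three elements this makes [k] vanish on such products,
    and comparing parities then gives: either [k = 0], or [G = t (u - k)] for
    a constant [t] and [k] vanishes on all products ([odd_part_alternative]).

    If [k = 0], then [G] is even and [f (x y) = f G + G f + p p] with
    [p := 'i H] odd.  For [p = 0] this is the sine addition law, whose solutions
    are forms B and C ([sine_law]).  For [p <> 0], associativity together with
    the parities of [f], [G], [p] shows that for some [b] the function
    [K := G + b f] satisfies [K (x y) = K K + 2 b p p] and
    [p (x y) = p K + K p] ([cosine_sine_law]).  If [b = 0] this is form D.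
    If [b <> 0] and [s^2 = 2 b], the functions [K + s p], [K - s p] and
    [K - 2 b f] are multiplicative, the first two are exchanged by [sigma] and
    the third is even: this is form E.

    If [k <> 0], then [u (x y) = 2 t u u + 2 t k k - H H].  The function
    [(x, y, z) |-> u (x y z)] is invariant under cyclic shifts, which determines
    all its parity components from one of them ([cyclic_parity]).  The outcome
    ([additive_perturbation]) is [t = 0] with [H] vanishing on products, giving
    form F, or [H = s k] with [s^2 = 2 t], so that [2 t u] is multiplicative,
    which is form A(i).  Form A(ii) is the instance [chi = 0] of form E.

    Conversely, each family solves the equation by a computation.  The products
    on which [f^e] does not vanish come from power sums in forms A and E
    ([power_sums_eq]) and from evaluating the addition laws on a few products in
    the other forms. *)

(** * Parity with respect to the involution *)

(** Used to deduce [c = d] from a linear combination [a = b] of known equations: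
    the second premise is then a ring identity. *)
Lemma eq_of_sub_eq (V : zmodType) (a b c d : V) :
  a = b -> c - d = a - b -> c = d.
Proof. by move=> -> /eqP; rewrite subrr subr_eq0 => /eqP. Qed.

Section Parity.
Variables (R : realType) (S : semigroupType) (sigma : {multiplicative S -> S}).
Hypothesis sigma_inv : involutive sigma.
Implicit Types (F f g h k p u v : S -> R[i]).

Definition odd_part F : S -> R[i] := fun x => (F x - F (sigma x)) / 2.

Lemma even_odd_decomposition F x : F x = even_part sigma F x + odd_part F x.
Proof. by rewrite /even_part /odd_part /star; field. Qed.

Lemma even_part_even F : is_even sigma (even_part sigma F).
Proof. by move=> x; rewrite /even_part /star sigma_inv addrC. Qed.

Lemma odd_part_odd F : is_odd sigma (odd_part F).
Proof. by move=> x; rewrite /odd_part /star sigma_inv; field. Qed.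

Lemma even_part_id F : is_even sigma F -> even_part sigma F =1 F.
Proof. by move=> eF x; rewrite /even_part (eF x); field. Qed.

Lemma not_zero_funP F : ~ F =1 zero_fun R (S := S) -> exists x, F x != 0.
Proof.
move=> nF; apply: contrapT => nE; apply: nF => x.
by apply: contrapT => Fx; apply: nE; exists x; apply/eqP.
Qed.

Lemma not_zero_fun F x : F x <> 0 -> ~ F =1 zero_fun R (S := S).
Proof. by move=> Fx F0; apply: Fx; rewrite F0. Qed.

(** Add and subtract the relation at [x] and at [sigma x].  Most functional
    identities below are exploited in this way, in one variable at a time. *)
Lemma even_odd_split u v : is_even sigma u -> is_odd sigma v ->
  (forall x, u x + v x = 0) -> forall x, u x = 0 /\ v x = 0.
Proof.
move=> eu ov H x; have Hx := H x; have Hs : u x - v x = 0.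
  by have := H (sigma x); rewrite [u _]eu [v _]ov.
have n2 : (2 : R[i]) != 0 by rewrite pnatr_eq0.
split; apply: (mulfI n2).
- by apply: (eq_of_sub_eq (congr2 +%R Hx Hs)); ring.
- by apply: (eq_of_sub_eq (congr2 +%R Hx (esym Hs))); ring.
Qed.

Lemma even_odd_free u v a b : is_even sigma u -> is_odd sigma v ->
    ~ u =1 zero_fun R (S := S) -> ~ v =1 zero_fun R (S := S) ->
  (forall x, u x * a + v x * b = 0) -> a = 0 /\ b = 0.
Proof.
move=> eu ov /not_zero_funP[x0 ux0] /not_zero_funP[x1 vx1] H.
have {}H := @even_odd_split (fun x => u x * a) (fun x => v x * b)
  (fun x => congr1 ( *%R^~ a) (eu x))
  (fun x => etrans (congr1 ( *%R^~ b) (ov x)) (mulNr _ _)) H.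
split; apply/eqP.
- by have [/eqP + _] := H x0; rewrite mulf_eq0 (negPf ux0).
- by have [_ /eqP] := H x1; rewrite mulf_eq0 (negPf vx1).
Qed.

End Parity.

Arguments odd_part {R S}.

(** * Reduction to an odd third function and to parity equations *)

Section Reduction.
Variables (R : realType) (S : semigroupType) (sigma : {multiplicative S -> S}).
Hypothesis sigma_inv : involutive sigma.
Implicit Types (F f g h k p u v : S -> R[i]).

Lemma solves_shift f g h (l : R[i]) : solves sigma f g h ->
  solves sigma f (fun x => g x + l ^+ 2 / 2 * f x + l * (h x - l * f x))
                 (fun x => h x - l * f x).
Proof. by move=> H x y; rewrite H; field. Qed.

(** [f^e] is not zero, so the dependence can be solved for [h^e]. *)
Lemma even_part_proportional f h :
    lin_dependent (even_part sigma h) (even_part sigma f) ->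
    nonzero_on_products (even_part sigma f) ->
  exists l, is_odd sigma (fun x => h x - l * f x).
Proof.
move=> [a [b [nab H]]] [x0 [y0 fe0]].
have na : a != 0.
  apply/eqP => a0; apply: nab; congr (_, _) => //.
  have /eqP := H (x0 * y0)%g; rewrite a0 mul0r add0r mulf_eq0.
  by case/orP => /eqP // /fe0.
exists (- b / a) => x; rewrite /star.
have {}H : even_part sigma h x = (- b / a) * even_part sigma f x.
  apply: (mulfI na); apply: (eq_of_sub_eq (H x)).
  by rewrite /even_part; field; rewrite na.
apply: (eq_of_sub_eq (congr1 ( *%R 2) H)).
by rewrite /even_part /star; field; rewrite na.
Qed.

(** The equation at [(x, sigma y)] and at [(sigma x, y)] gives the values of [f]
    at [x y] and at [sigma (x y)]; their mean and half-difference are this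
    formula and the next one. *)
Lemma even_equation f g h : solves sigma f g h -> is_odd sigma h ->
  forall x y, even_part sigma f (x * y)%g =
    even_part sigma f x * even_part sigma g y
    + even_part sigma g x * even_part sigma f y
    - (odd_part sigma f x * odd_part sigma g y
       + odd_part sigma g x * odd_part sigma f y + h x * h y).
Proof.
move=> H oh x y; rewrite /even_part /odd_part /star gmulfM.
have := H x (sigma y); rewrite sigma_inv => ->; rewrite H.
by rewrite ![h (sigma _)]oh; field.
Qed.

Lemma odd_equation f g h : solves sigma f g h -> is_odd sigma h ->
  forall x y, odd_part sigma f (x * y)%g =
    odd_part sigma g x * even_part sigma f y
    - even_part sigma f x * odd_part sigma g y
    + odd_part sigma f x * even_part sigma g y
    - even_part sigma g x * odd_part sigma f y.
Proof.
move=> H oh x y; rewrite /even_part /odd_part /star gmulfM.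
have := H x (sigma y); rewrite sigma_inv => ->; rewrite H.
by rewrite ![h (sigma _)]oh; field.
Qed.

(** The law for [k] is antisymmetric, so moving the first of three factors to
    the end changes the sign of [k]; three moves restore the product and give
    [k = - k].  Expanding the vanishing [k (x (y z))] in [x] and separating
    parities yields the two relations in [sep]. *)
Lemma odd_part_alternative u k v w : is_even sigma u -> is_odd sigma k ->
    is_even sigma v -> is_odd sigma w -> nonzero_on_products u ->
    ~ k =1 zero_fun R (S := S) ->
    (forall x y, k (x * y)%g = w x * u y - u x * w y + k x * v y - v x * k y) ->
  exists t, [/\ forall x, v x = t * u x, forall x, w x = - t * k x
              & forall x y, k (x * y)%g = 0].
Proof.
move=> eu ok ev ow [y0 [z0 /eqP nu]] nk H.
have cyc x y z : k (x * (y * z))%g = - k (y * (z * x))%g.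
  by rewrite [in RHS]mulgA (H x) (H (y * z)%g); ring.
have k3 x y z : k (x * (y * z))%g = 0.
  have e := etrans (cyc x y z)
    (congr1 -%R (etrans (cyc y z x) (congr1 -%R (cyc z x y)))).
  have /eqP : 2 * k (x * (y * z))%g = 0 by apply: (eq_of_sub_eq e); ring.
  by rewrite mulf_eq0 pnatr_eq0 => /eqP.
have sep x y z : u x * w (y * z)%g + v x * k (y * z)%g = 0 /\
                 w x * u (y * z)%g + k x * v (y * z)%g = 0.
  suff /(_ x)[/eqP] : forall t, - (u t * w (y * z)%g + v t * k (y * z)%g) = 0
      /\ w t * u (y * z)%g + k t * v (y * z)%g = 0.
    by rewrite oppr_eq0 => /eqP.
  apply: (@even_odd_split _ _ sigma (fun t => - (u t * w _ + v t * k _))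
                          (fun t => w t * u _ + k t * v _)) => t.
  - by rewrite /star [u (sigma _)]eu [v (sigma _)]ev.
  - by rewrite /star [w (sigma _)]ow [k (sigma _)]ok; ring.
  - by apply: (eq_of_sub_eq (k3 t y z)); rewrite (H t); ring.
pose t := v (y0 * z0)%g / u (y0 * z0)%g.
have wE x : w x = - t * k x.
  apply: (mulIf nu); apply: (eq_of_sub_eq (sep x y0 z0).2).
  by rewrite /t; field; rewrite nu.
have v_prod y z : v (y * z)%g = t * u (y * z)%g.
  have [x0 kx0] := not_zero_funP nk; apply: (mulfI kx0).
  by apply: (eq_of_sub_eq (sep x0 y z).2); rewrite wE; ring.
(* a non-zero value of k on products would make v proportional to u, and
   then the right-hand side of the equation for k cancels *)
have k2 y z : k (y * z)%g = 0.
  apply: contrapT => /eqP nkyz.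
  have vE x : v x = t * u x.
    apply: (mulIf nkyz); apply: (eq_of_sub_eq (sep x y z).1).
    by rewrite wE; ring.
  by move/eqP: nkyz; apply; rewrite H !wE !vE; ring.
exists t; split=> // x.
have [y1 ky1] := not_zero_funP nk.
have d0 : forall s, (v s - t * u s) * - k y1 + k s * (v y1 - t * u y1) = 0.
  by move=> s; apply: (eq_of_sub_eq (k2 s y1)); rewrite H !wE; ring.
have [/eqP + _] := even_odd_split (sigma := sigma)
  (u := fun s => (v s - t * u s) * - k y1)
  (v := fun s => k s * (v y1 - t * u y1))
  (fun s => ltac:(by rewrite /star [v (sigma _)]ev [u (sigma _)]eu))
  (fun s => ltac:(by rewrite /star [k (sigma _)]ok mulNr)) d0 x.
by rewrite mulf_eq0 oppr_eq0 (negPf ky1) orbF subr_eq0 => /eqP.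
Qed.

End Reduction.

(** * Addition laws with parity constraints *)

Section SineLaws.
Variables (R : realType) (S : semigroupType) (sigma : {multiplicative S -> S}).
Hypothesis sigma_inv : involutive sigma.
Implicit Types (F f g h k p u v : S -> R[i]).

(** Associativity of [x y t] gives [f x * A y t = f t * A x y] for the
    multiplicativity defect [A] of [g]; exchanging arguments twice makes [A]
    proportional to [f * f]. *)
Lemma sine_law f g : ~ f =1 zero_fun R (S := S) ->
    (forall x y, f (x * y)%g = f x * g y + g x * f y) ->
  exists a, forall x y, g (x * y)%g = g x * g y + a * (f x * f y).
Proof.
move=> /not_zero_funP[z nz] H.
pose A x y := g (x * y)%g - g x * g y.
have swap x y t : f x * A y t = f t * A x y.
  have e : f (x * (y * t))%g = f (x * y * t)%g by rewrite mulgA.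
  by rewrite !H in e; apply: (eq_of_sub_eq e); rewrite /A; ring.
exists (A z z / f z ^+ 2) => y t.
have e := congr1 ( *%R (f z)) (swap z y t).
have e' := congr1 ( *%R (f t)) (swap z z y).
apply: (mulfI nz); apply: (mulfI nz).
by apply: (eq_of_sub_eq (congr2 +%R e e')); rewrite /A; field; rewrite nz.
Qed.

(** Linear independence of the even [f] and the odd [p] is what makes the
    argument work: associativity expresses the defects [A] of [g] and [B] of [p]
    through [f] and [p], and comparing coefficients leaves only two constants
    [a] and [b].  Associativity of [p] on triple products forces [a = b^2]. *)
Lemma cosine_sine_law f g p : is_even sigma f -> is_even sigma g ->
    is_odd sigma p ->
    ~ f =1 zero_fun R (S := S) -> ~ p =1 zero_fun R (S := S) ->
    (forall x y, f (x * y)%g = f x * g y + g x * f y + p x * p y) ->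
  exists b, let G x := g x + b * f x in
    (forall x y, p (x * y)%g = p x * G y + G x * p y) /\
    (forall x y, G (x * y)%g = G x * G y + 2 * b * (p x * p y)).
Proof.
move=> ef eg op nf np H.
have [z0 nz0] := not_zero_funP nf; have [z1 nz1] := not_zero_funP np.
have n2 : (2 : R[i]) != 0 by rewrite pnatr_eq0.
pose A x y := g (x * y)%g - g x * g y.
pose B x y := p (x * y)%g - g x * p y.
have A_even x y : A (sigma x) (sigma y) = A x y.
  by rewrite /A -gmulfM ![g (sigma _)]eg.
have B_odd x y : B (sigma x) (sigma y) = - B x y.
  by rewrite /B -gmulfM ![p (sigma _)]op [g (sigma _)]eg; ring.
have assoc x y z : f x * A y z + p x * (p (y * z)%g - p y * g z)
                   = f z * A x y + p z * B x y.
  have e : f (x * (y * z))%g = f (x * y * z)%g by rewrite mulgA.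
  by rewrite !H in e; apply: (eq_of_sub_eq e); rewrite /A /B; ring.
(* averaging over z0 and sigma z0 kills the odd p, and subtracting over z1
   kills the even f: the two defects are combinations of f and p in x *)
have [al [be AE]] : exists al be, forall x y, A x y = f x * al y + p x * be y.
  exists (fun y => (A y z0 + A y (sigma z0)) / (2 * f z0)).
  exists (fun y => ((p (y * z0)%g - p y * g z0)
      + (p (y * sigma z0)%g - p y * g (sigma z0))) / (2 * f z0)) => x y.
  apply: (mulfI nz0); apply: (mulfI n2).
  have := assoc x y (sigma z0); rewrite [f (sigma _)]ef [p (sigma _)]op => e.
  apply: (eq_of_sub_eq (esym (congr2 +%R (assoc x y z0) e))).
  by field; rewrite nz0.
have [ga [de BE]] : exists ga de, forall x y, B x y = f x * ga y + p x * de y.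
  exists (fun y => (A y z1 - A y (sigma z1)) / (2 * p z1)).
  exists (fun y => ((p (y * z1)%g - p y * g z1)
      - (p (y * sigma z1)%g - p y * g (sigma z1))) / (2 * p z1)) => x y.
  apply: (mulfI nz1); apply: (mulfI n2).
  have := assoc x y (sigma z1); rewrite [f (sigma _)]ef [p (sigma _)]op => e.
  apply: (eq_of_sub_eq (congr2 +%R (esym (assoc x y z1)) e)).
  by field; rewrite nz1.
have free a b : (forall x, f x * a + p x * b = 0) -> a = 0 /\ b = 0.
  exact: even_odd_free.
have par1 y : al y - al (sigma y) = 0 /\ be y + be (sigma y) = 0.
  apply: free => x; apply: (eq_of_sub_eq (esym (A_even x y))).
  by rewrite !AE [f (sigma _)]ef [p (sigma _)]op; ring.
have par2 y : ga y + ga (sigma y) = 0 /\ de y - de (sigma y) = 0.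
  apply: free => x; have e : B x y + B (sigma x) (sigma y) = 0.
    by rewrite B_odd subrr.
  by apply: (eq_of_sub_eq e); rewrite !BE [f (sigma _)]ef [p (sigma _)]op; ring.
have coeff y z : f y * al z + p y * be z - (f z * al y + p z * ga y) = 0 /\
    g y * p z + f y * ga z + p y * (de z - g z) - (f z * be y + p z * de y) = 0.
  apply: free => x; have Bp t s : p (t * s)%g = g t * p s + B t s.
    by rewrite /B; ring.
  by apply: (eq_of_sub_eq (assoc x y z)); rewrite !Bp !AE !BE; ring.
have sym_fp y z : f y * al z - f z * al y = 0 /\ p y * be z - p z * ga y = 0.
  apply: (@even_odd_split _ _ sigma (fun t => f t * al z - f z * al t)
                          (fun t => p t * be z - p z * ga t)) => t.
  - rewrite /star [f (sigma _)]ef.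
    by apply: (eq_of_sub_eq (congr1 ( *%R (f z)) (par1 t).1)); ring.
  - rewrite /star [p (sigma _)]op.
    by apply: (eq_of_sub_eq (congr1 ( *%R (- p z)) (par2 t).1)); ring.
  - by apply: (eq_of_sub_eq (coeff t z).1); ring.
pose a := al z0 / f z0; pose b := ga z1 / p z1.
have alE y : al y = a * f y.
  apply: (mulfI nz0); apply: (eq_of_sub_eq (sym_fp z0 y).1).
  by rewrite /a; field; rewrite nz0.
have beE y : be y = b * p y.
  apply: (mulfI nz1); apply: (eq_of_sub_eq (sym_fp z1 y).2).
  by rewrite /b; field; rewrite nz1.
have gaE y : ga y = b * p y.
  apply: (mulfI nz1); apply: (eq_of_sub_eq (esym (sym_fp y z1).2)).
  by rewrite beE; ring.
pose G x := g x + b * f x.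
have deE y : de y = G y.
  have [] := @even_odd_split _ _ sigma (fun t => (G t - de t) * p z1)
    (fun t => p t * (de z1 - G z1)) _ _ _ y => [t|t|t|/eqP + _].
  - rewrite /star /G [f (sigma _)]ef [g (sigma _)]eg.
    by apply: (eq_of_sub_eq (congr1 ( *%R (p z1)) (par2 t).2)); ring.
  - by rewrite /star [p (sigma _)]op mulNr.
  - by apply: (eq_of_sub_eq (coeff t z1).2); rewrite gaE beE /G; ring.
  by rewrite mulf_eq0 (negPf nz1) orbF subr_eq0 => /eqP.
have pE x y : p (x * y)%g = p x * G y + G x * p y.
  by apply: (eq_of_sub_eq (BE x y)); rewrite gaE deE /B /G; ring.
have GE x y : G (x * y)%g = G x * G y + (a - b ^+ 2) * (f x * f y)
                            + 2 * b * (p x * p y).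
  by apply: (eq_of_sub_eq (AE x y)); rewrite /A alE beE /G H; ring.
(* the remaining term (a - b^2) f f is excluded by associativity of p *)
suff d0 : a - b ^+ 2 = 0.
  by exists b; split=> // x y; apply: etrans (GE x y) _; rewrite d0 /G; ring.
have [_ /eqP] : (a - b ^+ 2) * (f z0 * p z0) = 0 /\
    - ((a - b ^+ 2) * (f z0 * f z0)) = 0.
  apply: free => t; have e : p (t * (z0 * z0))%g = p (t * z0 * z0)%g.
    by rewrite mulgA.
  by rewrite !pE !GE in e; apply: (eq_of_sub_eq (esym e)); ring.
by rewrite oppr_eq0 !mulf_eq0 (negPf nz0) !orbF => /eqP.
Qed.

(** Let [T x y z := u (x y z)].  Formula [expand] shows the part of [T] that is
    even in the first variable; by cyclic invariance the parts even in the
    second or in the third variable are known too.  As [T] is unchanged when all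
    three variables are flipped, these parts determine [T], and comparing with
    [expand] isolates the term with [h]. *)
Lemma cyclic_parity u h k (t : R[i]) : is_even sigma u -> is_odd sigma h ->
    is_odd sigma k -> (forall x y, k (x * y)%g = 0) ->
    let B x y := 2 * t * (k x * k y) - h x * h y in
    (forall x y, u (x * y)%g = 2 * t * (u x * u y) + B x y) ->
  forall x y z, - (h x * h (y * z)%g) = 2 * t * (u y * B x z + u z * B x y).
Proof.
move=> eu oh ok k2 B H x y z.
have expand a b c : u (a * (b * c))%g =
    2 * t * (u a * (2 * t * (u b * u c) + B b c)) - h a * h (b * c)%g.
  by rewrite !H /B k2; ring.
have cyc a b c : u (a * (b * c))%g = u (b * (c * a))%g.
  by rewrite [in RHS]mulgA (H a) (H (b * c)%g) /B; ring.
have even_in_first a b c : u (a * (b * c))%g + u (sigma a * (b * c))%g =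
    2 * (2 * t * (u a * (2 * t * (u b * u c) + B b c))).
  by rewrite !expand [u (sigma _)]eu [h (sigma _)]oh; ring.
have flip a b c : u (sigma a * (sigma b * c))%g = u (a * (b * sigma c))%g.
  by rewrite -[RHS]eu /star !gmulfM sigma_inv.
have oB a b : B (sigma a) b = - B a b.
  by rewrite /B [k (sigma _)]ok [h (sigma _)]oh; ring.
(* e1 + e2 - e3 is an equation for 2 T, as the flipped values cancel *)
have e1 := even_in_first y z x; have e2 := even_in_first z x y.
have e3 := even_in_first x (sigma y) z.
rewrite -(cyc x y z) -(cyc x (sigma y) z) in e1.
rewrite (cyc z x y) (cyc (sigma z) x y) in e2.
rewrite flip oB [u (sigma y)]eu in e3.
have n2 : (2 : R[i]) != 0 by rewrite pnatr_eq0.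
have e4 : 2 * u (x * (y * z))%g = 2 * (2 * t * (2 * t * (u x * u y * u z)
    + u x * B y z + u y * B z x + u z * B x y)).
  by apply: (eq_of_sub_eq (congr2 +%R (congr2 +%R e1 e2) (esym e3))); ring.
have := mulfI n2 e4; rewrite expand => e.
by apply: (eq_of_sub_eq e); rewrite /B; ring.
Qed.

Lemma symmetrized_odd_eq0 u v : is_even sigma u -> is_odd sigma v ->
    ~ u =1 zero_fun R (S := S) ->
  (forall x y, u x * v y + u y * v x = 0) -> forall x, v x = 0.
Proof.
move=> eu ov /not_zero_funP[x0 nx0] H x.
have [/eqP + _] := even_odd_split (sigma := sigma)
  (u := fun t => u t * v x) (v := fun t => u x * v t)
  (fun t => congr1 ( *%R^~ _) (eu t))
  (fun t => etrans (congr1 ( *%R _) (ov t)) (mulrN _ _)) (H^~ x) x0.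
by rewrite mulf_eq0 (negPf nx0) => /eqP.
Qed.

(** The left side of [main] depends on [(y, z)] only through [h (y z)].  For
    [t <> 0], eliminating [h (y z)] shows that [h] is proportional to [k]; hence
    it vanishes on products and [main] says that the perturbation
    [B] of the multiplicative law is zero.  For [t = 0], [main] with [x]
    replaced by [y z] reads [h (y z) ^+ 2 = 0]. *)
Lemma additive_perturbation u h k (t : R[i]) : is_even sigma u ->
    is_odd sigma h -> is_odd sigma k -> ~ u =1 zero_fun R (S := S) ->
    ~ k =1 zero_fun R (S := S) -> (forall x y, k (x * y)%g = 0) ->
    (forall x y, u (x * y)%g = 2 * t * (u x * u y)
                               + (2 * t * (k x * k y) - h x * h y)) ->
  (t = 0 /\ forall x y, h (x * y)%g = 0)
  \/ (t <> 0 /\ exists2 s, s ^+ 2 = 2 * t & forall x, h x = s * k x).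
Proof.
move=> eu oh ok nu nk k2 H.
pose B x y := 2 * t * (k x * k y) - h x * h y.
have main x y z : - (h x * h (y * z)%g) = 2 * t * (u y * B x z + u z * B x y).
  exact: cyclic_parity.
have [t0|nt] := eqVneq t 0; [left|right]; split=> //.
- move=> x y; have /eqP := main (x * y)%g x y.
  by rewrite t0 mulr0 mul0r oppr_eq0 mulf_eq0 orbb => /eqP.
- exact/eqP.
have n2t : 2 * t != 0 by rewrite mulf_eq0 pnatr_eq0.
have oB x y : B x (sigma y) = - B x y.
  by rewrite /B [k (sigma _)]ok [h (sigma _)]oh; ring.
have [x1 nx1] := not_zero_funP nk.
(* two values of the first argument eliminate h on products *)
have exch x y : h y * k x = h x * k y.
  have /(_ x1) : forall z, h y * B x z - h x * B y z = 0.
    apply: (symmetrized_odd_eq0 eu _ nu) => [z|a b].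
      by rewrite /star !oB; ring.
    apply: (mulfI n2t); have e := congr1 ( *%R (- h y)) (main x b a).
    apply: (eq_of_sub_eq (congr2 +%R (congr1 ( *%R (- h y)) (main x a b))
                                     (congr1 ( *%R (h x)) (main y a b)))).
    by ring.
  move=> e; apply: (mulfI nx1); apply: (mulfI n2t); apply: (eq_of_sub_eq e).
  by rewrite /B; ring.
pose s := h x1 / k x1.
have hE x : h x = s * k x.
  by apply: (mulfI nx1); rewrite mulrC -exch /s; field; rewrite nx1.
exists s => //; apply/eqP; rewrite -subr_eq0.
have /(_ x1)/eqP : forall z, B x1 z = 0.
  apply: (symmetrized_odd_eq0 eu _ nu) => [z|a b]; first exact: oB.
  apply: (mulfI n2t); apply: (eq_of_sub_eq (esym (main x1 a b))).
  by rewrite (hE (a * b)%g) k2; ring.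
have -> : B x1 x1 = - ((s ^+ 2 - 2 * t) * (k x1 * k x1)) by rewrite /B hE; ring.
by rewrite oppr_eq0 !mulf_eq0 (negPf nx1) !orbF.
Qed.

End SineLaws.
(** * The equation has only the listed solutions *)

Section Solutions.
Variables (R : realType) (S : semigroupType) (sigma : {multiplicative S -> S}).
Hypothesis sigma_inv : involutive sigma.
Implicit Types (F f g h k p u v G H : S -> R[i]).

(** With [c^2 = a], the functions [G + c f] and [G - c f] are multiplicative;
    the degenerate value [a = 0] gives form C. *)
Lemma sine_case f G g h (l : R[i]) : is_even sigma f -> is_even sigma G ->
    nonzero_on_products f ->
    (forall x y, f (x * y)%g = f x * G y + G x * f y) ->
    (forall x, g x = G x - l ^+ 2 / 2 * f x) -> (forall x, h x = l * f x) ->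
  form_B sigma f g h \/ form_C sigma f g h.
Proof.
move=> ef eG [x0 [y0 nf]] fM gE hE.
have [a GM] := sine_law (not_zero_fun nf) fM.
have [a0|na] := eqVneq a 0; [right|left].
  exists G, f, l; split=> //; split=> //.
  - by move=> x y; rewrite GM a0; ring.
  - by move=> G0; apply: nf; rewrite fM !G0 /zero_fun; ring.
pose c := sqrtC a; have c2 : c ^+ 2 = a by rewrite /c sqrtCK.
have nc : c != 0 by rewrite /c sqrtC_eq0.
have n2 : (2 : R[i]) != 0 by rewrite pnatr_eq0.
exists (fun x => G x + c * f x), (fun x => G x - c * f x), l, c; split.
- split=> [x y|x y|e]; [by rewrite GM fM -c2; ring..|].
  apply: nf; apply: (mulfI nc); apply: (mulfI n2).
  by apply: (eq_of_sub_eq (e (x0 * y0)%g)); ring.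
- exact/eqP.
- by split=> x; rewrite /star [f _]ef [G _]eG.
- by split=> x; rewrite ?gE ?hE; field; rewrite ?nc.
Qed.

(** Form D and form E are the cases [b = 0] and [b <> 0] of
    [cosine_sine_law]. *)
Lemma cosine_sine_case f G H g h (l : R[i]) : is_even sigma f ->
    is_even sigma G -> is_odd sigma H -> ~ H =1 zero_fun R (S := S) ->
    nonzero_on_products f ->
    (forall x y, f (x * y)%g = f x * G y + G x * f y - H x * H y) ->
    (forall x, g x = G x - l ^+ 2 / 2 * f x - l * H x) ->
    (forall x, h x = H x + l * f x) ->
  form_D sigma f g h \/ form_E sigma f g h.
Proof.
move=> ef eG oH nH [x0 [y0 nf]] fM gE hE.
have [z nz] := not_zero_funP nH.
pose j : R[i] := 'i; have j2 : j ^+ 2 = -1 by exact: sqrCi.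
have nj : j != 0 by exact: neq0Ci.
pose p x := j * H x.
have op : is_odd sigma p by move=> x; rewrite /p /star [H _]oH mulrN.
have np : ~ p =1 zero_fun R (S := S).
  apply: (@not_zero_fun _ _ _ z); apply/eqP.
  by rewrite /p mulf_eq0 negb_or nj nz.
have fM' x y : f (x * y)%g = f x * G y + G x * f y + p x * p y.
  apply: (eq_of_sub_eq (congr1 ( *%R (- (H x * H y))) j2)).
  by rewrite /p fM; ring.
have [b [pM KM]] := cosine_sine_law ef eG op (not_zero_fun nf) np fM'.
have [b0|nb] := eqVneq b 0; [left|right].
  have K0 x : G x + b * f x = G x by rewrite b0 mul0r addr0.
  exists G, p, f, l; split=> //.
  - by move=> x y; have := KM x y; rewrite !K0 b0 => ->; ring.
  - by split=> // x y; rewrite pM !K0; ring.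
  - split=> // x; rewrite ?gE ?hE /p -/j.
    + by apply: (eq_of_sub_eq (congr1 ( *%R (- l * H x)) j2)); ring.
    + by apply: (eq_of_sub_eq (congr1 ( *%R (H x)) j2)); ring.
pose K x := G x + b * f x.
pose s := sqrtC (2 * b); have s2 : s ^+ 2 = 2 * b by rewrite /s sqrtCK.
have n2 : (2 : R[i]) != 0 by rewrite pnatr_eq0.
have ns : s != 0 by rewrite /s sqrtC_eq0 mulf_eq0 negb_or n2 nb.
have bE : b = s ^+ 2 / 2 by rewrite s2; field.
(* c is fixed by H = c (chi1 - chi1 o sigma) = 2 c s 'i H *)
pose c := - j / (2 * s).
have c2 : c ^+ 2 = - 1 / (4 * s ^+ 2).
  by rewrite /c expr_div_n sqrrN j2; field; rewrite ns.
have csj : c * s * j = 1 / 2.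
  apply: (eq_of_sub_eq (congr1 ( *%R (- 1 / 2)) j2)).
  by rewrite /c; field; rewrite ns.
pose chi1 x := K x + s * p x.
have chi1S x : star sigma chi1 x = K x - s * p x.
  by rewrite /star /chi1 /K /p [G _]eG [f _]ef [H _]oH; ring.
have nchi1 : ~ star sigma chi1 =1 chi1.
  move=> e; move/eqP: nz; apply; apply: (mulfI nj); apply: (mulfI ns).
  apply: (mulfI n2); apply: (eq_of_sub_eq (esym (e z))).
  by rewrite chi1S /chi1 /p; ring.
have echi : is_even sigma (fun x => K x - 2 * b * f x).
  by move=> x; rewrite /star /K [G _]eG [f _]ef.
exists (fun x => K x - 2 * b * f x), chi1, l, c; split.
- split=> x y; first by rewrite [K (x * y)%g]KM fM' /K; ring.
  by rewrite /chi1 pM [K (x * y)%g]KM -s2 /K; ring.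
- apply/eqP.
  by rewrite /c mulf_eq0 oppr_eq0 invr_eq0 mulf_eq0 !negb_or nj n2 ns.
- split=> // e; apply: nchi1 => x.
  by rewrite -[RHS]e -[RHS]echi /star e.
- split=> x; rewrite !chi1S ?gE ?hE /chi1.
  + by rewrite c2 /K bE; field; rewrite ns.
  + rewrite -[4 * l ^+ 2 * c ^+ 2]mulrA c2.
    apply: (eq_of_sub_eq (congr1 ( *%R (2 * l * H x)) csj)).
    by rewrite /K /p bE; field; rewrite ns.
  + rewrite c2.
    apply: (eq_of_sub_eq (congr1 ( *%R (- 2 * H x)) csj)).
    by rewrite /K /p bE; field; rewrite ns.
Qed.


(** In form A the parameters are read off from [t], [s] and the shift [l]:
    [lambda^2 - 2 mu = 2 t] fixes [mu], and [eta = l + s].  The condition on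
    [eta] is [s^2 = 2 t], and its second alternative is [s = - l]. *)
Lemma odd_part_case f G H g h (l : R[i]) : solves sigma f G H ->
    is_odd sigma H -> nonzero_on_products (even_part sigma f) ->
    ~ odd_part sigma f =1 zero_fun R (S := S) ->
    (forall x, g x = G x - l ^+ 2 / 2 * f x - l * H x) ->
    (forall x, h x = H x + l * f x) ->
  form_A sigma f g h \/ form_F sigma f g h.
Proof.
move=> sol oH nu nk gE hE.
set u := even_part sigma f in nu *; set k := odd_part sigma f in nk *.
have fE x : f x = u x + k x by exact: even_odd_decomposition.
have eu : is_even sigma u by exact: even_part_even.
have ok : is_odd sigma k by exact: odd_part_odd.
have [t [vE wE k2]] := odd_part_alternative eu ok
  (even_part_even sigma_inv G) (odd_part_odd sigma_inv G) nu nk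
  (odd_equation sigma_inv sol oH).
have GE x : G x = t * u x - t * k x.
  by rewrite (even_odd_decomposition sigma G) vE wE mulNr.
have uM x y : u (x * y)%g = 2 * t * (u x * u y)
                            + (2 * t * (k x * k y) - H x * H y).
  by rewrite [LHS](even_equation sigma_inv sol oH) !vE !wE -/u -/k; ring.
have k_add : additive_wrt (zero_fun R (S := S)) k.
  by move=> x y; rewrite k2 /zero_fun; ring.
have n2 : (2 : R[i]) != 0 by rewrite pnatr_eq0.
have [x0 [y0 nu0]] := nu.
have nu' := not_zero_fun nu0.
have [[t0 H2]|[/eqP nt [s s2 HE]]] :=
  additive_perturbation sigma_inv eu oH ok nu' nk k2 uM; [right|left].
- pose j : R[i] := 'i; have j2 : j ^+ 2 = -1 by exact: sqrCi.
  exists (fun x => - j * H x), u, k, l; split=> //.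
  + split=> [x y|e]; first by rewrite H2 /zero_fun; ring.
    apply: nu0; have H0 x : H x = 0.
      apply: (eq_of_sub_eq (congr2 +%R (congr1 ( *%R j) (e x))
                              (congr1 ( *%R (H x)) j2))).
      by rewrite /zero_fun; ring.
    by rewrite uM t0 !H0; ring.
  + move=> x y; rewrite uM t0 /zero_fun.
    by apply: (eq_of_sub_eq (congr1 ( *%R (- (H x * H y))) j2)); ring.
  + by split=> // x; rewrite /star [H _]oH; ring.
  + split=> // x; rewrite ?gE ?hE ?GE fE ?t0 -/j.
    * by apply: (eq_of_sub_eq (congr1 ( *%R (- l * H x)) j2)); ring.
    * by apply: (eq_of_sub_eq (congr1 ( *%R (H x)) j2)); ring.
have n2t : 2 * t != 0 by rewrite mulf_eq0 negb_or n2 nt.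
have uM' x y : u (x * y)%g = 2 * t * (u x * u y).
  rewrite uM !HE.
  by apply: (eq_of_sub_eq (congr1 ( *%R (- (k x * k y))) s2)); ring.
pose mu := (l ^+ 2 - 2 * t) / 2.
have dE : l ^+ 2 - 2 * mu = 2 * t by rewrite /mu; field.
pose rho := sqrtC (- (1 / (4 * (2 * t)))).
have msE x : star sigma (fun x => 2 * t * u x) x = 2 * t * u x.
  by rewrite /star [u _]eu.
exists (fun x => 2 * t * u x), k, l, mu, (l + s), rho.
rewrite /= dE; split=> //.
- by move=> x y; rewrite uM'; ring.
- split; [exact/eqP | | by rewrite sqrtCK].
  apply/eqP; rewrite sqrtC_eq0 oppr_eq0 mul1r invr_eq0 mulf_eq0 negb_or n2t.
  by rewrite pnatr_eq0.
- split=> x; rewrite !msE ?gE ?hE ?HE ?GE fE.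
  + by field; rewrite nt.
  + apply: (eq_of_sub_eq (congr1 ( *%R (k x / 2)) s2)).
    by rewrite /mu; field; rewrite nt.
  + by field; rewrite nt.
- left; split=> [x|e|]; first by rewrite msE.
    apply: nu0; apply: (mulfI n2t); rewrite mulr0; exact: e.
  have [e0|ne] := eqVneq (l + s) 0; [right|left].
    have lE : l = - s by apply: (eq_of_sub_eq e0); ring.
    split=> //; first by rewrite /mu lE sqrrN s2 subrr mul0r.
    by move=> l0; move: n2t; rewrite -s2 -[s]opprK -lE l0 oppr0 expr0n eqxx.
  split; last exact/eqP.
  by apply: (eq_of_sub_eq s2); rewrite /mu; field.
Qed.

Lemma solution_forms f g h : solves sigma f g h ->
    lin_dependent (even_part sigma h) (even_part sigma f) ->
    nonzero_on_products (even_part sigma f) ->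
  form_A sigma f g h \/ form_B sigma f g h \/ form_C sigma f g h \/
  form_D sigma f g h \/ form_E sigma f g h \/ form_F sigma f g h.
Proof.
move=> sol dep nu; have [l oH] := even_part_proportional dep nu.
have := solves_shift l sol.
set H := fun x => h x - l * f x in oH *; set G := (G in solves _ _ G _) => sol'.
have gE x : g x = G x - l ^+ 2 / 2 * f x - l * H x by rewrite /G /H; ring.
have hE x : h x = H x + l * f x by rewrite /H; ring.
have [k0|nk] := pselect (odd_part sigma f =1 zero_fun R (S := S)); last first.
  by have := odd_part_case sol' oH nu nk gE hE; tauto.
have uE x : f x = even_part sigma f x.
  by rewrite (even_odd_decomposition sigma f) k0 addr0.
have ef : is_even sigma f.
  by move=> x; rewrite /star !uE; exact: even_part_even.
have nf : nonzero_on_products f.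
  by have [x [y nxy]] := nu; exists x, y; rewrite uE.
have [x0 [y0 nf0]] := nf.
have w_split s : - (f s * odd_part sigma G (x0 * y0)%g)
                 + odd_part sigma G s * f (x0 * y0)%g = 0.
  have := odd_equation sigma_inv sol' oH s (x0 * y0)%g.
  by rewrite !k0 -!uE /zero_fun => /esym e; apply: (eq_of_sub_eq e); ring.
have w0 x : odd_part sigma G x = 0.
  have [_ /eqP] := even_odd_split (sigma := sigma)
    (u := fun s => - (f s * odd_part sigma G (x0 * y0)%g))
    (v := fun s => odd_part sigma G s * f (x0 * y0)%g)
    (fun s => congr1 -%R (congr1 ( *%R^~ _) (ef s)))
    (fun s => etrans (congr1 ( *%R^~ _) (odd_part_odd sigma_inv G s))
                     (mulNr _ _))
    w_split x.
  by rewrite mulf_eq0 (negPf (introN eqP nf0)) orbF => /eqP.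
have GE x : G x = even_part sigma G x.
  by rewrite {1}(even_odd_decomposition sigma G) w0 addr0.
have eG : is_even sigma G.
  by move=> x; rewrite /star !GE; exact: even_part_even.
have fM x y : f (x * y)%g = f x * G y + G x * f y - H x * H y.
  rewrite uE (even_equation sigma_inv sol' oH) -!uE -!GE !w0 !k0 /zero_fun.
  by ring.
have [H0|nH] := pselect (H =1 zero_fun R (S := S)).
  have fM' x y : f (x * y)%g = f x * G y + G x * f y.
    by rewrite fM !H0 mulr0 subr0.
  have gE' x : g x = G x - l ^+ 2 / 2 * f x by rewrite gE H0 mulr0 subr0.
  have hE' x : h x = l * f x by rewrite hE H0 add0r.
  by have := sine_case ef eG nf fM' gE' hE'; tauto.
by have := cosine_sine_case ef eG oH nH nf fM gE hE; tauto.
Qed.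

End Solutions.

(** * The listed triples are solutions *)

Section Converse.
Variables (R : realType) (S : semigroupType) (sigma : {multiplicative S -> S}).
Hypothesis sigma_inv : involutive sigma.
Implicit Types (F f g h k m chi phi psi : S -> R[i]).

Lemma lin_dependent_of_odd f h (l : R[i]) :
    (forall x, h (sigma x) - l * f (sigma x) = - (h x - l * f x)) ->
  lin_dependent (even_part sigma h) (even_part sigma f).
Proof.
move=> H; exists 1, (- l); split=> [[] /eqP|x]; first by rewrite oner_eq0.
apply: (eq_of_sub_eq (congr1 ( *%R (1 / 2)) (H x))).
by rewrite /even_part /star; field.
Qed.

Lemma nonzero_on_productsP F :
  ~ (forall x y, F (x * y)%g = 0) -> nonzero_on_products F.
Proof.
move=> nF; apply: contrapT => nE; apply: nF => x y.
by apply: contrapT => Fxy; apply: nE; exists x, y.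
Qed.

(** Equality in the Cauchy-Schwarz relation between the power sums of exponents
    2, 3, 4, in the form of the identity
    [(a^2 + b^2) (a^4 + b^4) - (a^3 + b^3)^2 = (a b (a - b))^2]. *)
Lemma power_sums_eq (a b c : R[i]) : a ^+ 2 + b ^+ 2 = 2 * c ^+ 2 ->
    a ^+ 3 + b ^+ 3 = 2 * c ^+ 3 -> a ^+ 4 + b ^+ 4 = 2 * c ^+ 4 -> a = b.
Proof.
move=> e2 e3 e4.
have /eqP : (a * b * (a - b)) ^+ 2 = 0.
  have -> : (a * b * (a - b)) ^+ 2
      = (a ^+ 2 + b ^+ 2) * (a ^+ 4 + b ^+ 4) - (a ^+ 3 + b ^+ 3) ^+ 2 by ring.
  by rewrite e2 e3 e4; ring.
rewrite expf_eq0 /= !mulf_eq0 subr_eq0.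
have one_zero (d : R[i]) : d ^+ 2 = 2 * c ^+ 2 -> d ^+ 4 = 2 * c ^+ 4 -> d = 0.
  move=> d2 d4; have /eqP : 2 * c ^+ 4 = 0.
    have d22 := congr1 (@GRing.exp _ ^~ 2) d2.
    by apply: (eq_of_sub_eq (congr2 +%R (esym d22) d4)); ring.
  rewrite mulf_eq0 pnatr_eq0 expf_eq0 /= => /eqP c0.
  by move/eqP: d2; rewrite c0 expr0n mulr0 expf_eq0 => /eqP.
case/orP => [/orP[]|] /eqP // z0; rewrite z0 !expr0n ?(add0r, addr0) in e2 e4.
  by rewrite z0 (one_zero b).
by rewrite z0 (one_zero a).
Qed.

(** Evaluation at [x x], [x (x x)] and [(x x) (x x)] gives power sums. *)
Lemma even_of_products m chi : multiplicative_fun m -> multiplicative_fun chi ->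
  (forall x y, m (x * y)%g + star sigma m (x * y)%g = 2 * chi (x * y)%g) ->
  star sigma m =1 m.
Proof.
move=> mM cM H x; rewrite /star; apply/esym.
apply: (@power_sums_eq _ _ (chi x)).
- by have := H x x; rewrite /star gmulfM !mM cM -!expr2.
- by have := H x (x * x)%g; rewrite /star !gmulfM !mM !cM -!expr2 -!exprS.
- have := H (x * x)%g (x * x)%g.
  by rewrite /star !gmulfM !mM !cM -!expr2 -!exprM.
Qed.

Let conclusion f g h :=
  [/\ solves sigma f g h,
      lin_dependent (even_part sigma h) (even_part sigma f)
    & nonzero_on_products (even_part sigma f)].

Lemma form_A_solves f g h : form_A sigma f g h -> conclusion f g h.
Proof.
move=> [m [k [l [mu [eta [rho [mM [kM ok] [/eqP nd nrho rho2]]]]]]]].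
set d := l ^+ 2 - 2 * mu in nd rho2 *; rewrite /star.
move=> [fE gE hE] alt.
have k2 x y : k (x * y)%g = 0 by rewrite kM /zero_fun; ring.
have ms x : (m (sigma (sigma x)) = m x) by rewrite sigma_inv.
have muE : mu = (l ^+ 2 - d) / 2 by rewrite /d; field.
clearbody d.
have fxsy x y : f (x * sigma y)%g =
    1 / (2 * d) * (m x * m (sigma y) + m (sigma x) * m y).
  by rewrite fE gmulfM sigma_inv !mM k2 addr0.
split.
- move=> x y; rewrite fxsy !fE !gE !hE.
  case: alt => [[em _ cond]|[_ k0]].
    rewrite -!em.
    have cE : eta ^+ 2 - 2 * l * eta + 2 * mu = 0.
      by case: cond => [[-> _]|[-> -> _]] //; ring.
    rewrite muE in cE *.
    apply: (eq_of_sub_eq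
      (congr1 ( *%R ((m x * k y + k x * m y) / (2 * d))) cE)).
    by field; rewrite nd.
  rewrite !k0 /zero_fun muE.
  pose Q t := m t - m (sigma t).
  apply: (eq_of_sub_eq (congr1 ( *%R (- (Q x * Q y))) rho2)).
  by rewrite /Q; field; rewrite nd.
- apply: (@lin_dependent_of_odd _ _ l) => x.
  rewrite !hE !fE !ms [k (sigma x)]ok.
  by field; rewrite nd.
- apply: nonzero_on_productsP => H.
  have H' x y : m (x * y)%g + m (sigma (x * y)%g) = 0.
    have e := H x y; rewrite /even_part /star !fE !ms [k (sigma _)]ok in e.
    apply: (eq_of_sub_eq (congr1 ( *%R (2 * d)) e)).
    by field; rewrite nd.
  have em : star sigma m =1 m.
    apply: (even_of_products (chi := zero_fun R (S := S))) => // x y.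
      by rewrite /zero_fun mulr0.
    by rewrite /star H' /zero_fun mulr0.
  case: alt => [[_ nm _]|[nm _]]; last by apply: nm => x; exact/esym/em.
  apply: nm => x; have /eqP := H' x x.
  rewrite [m (sigma _)]em mM -mulr2n mulrn_eq0 mulf_eq0 orbb => /eqP //.
Qed.

Lemma form_B_solves f g h : form_B sigma f g h -> conclusion f g h.
Proof.
move=> [c1 [c2 [l [c [[M1 M2 n12] /eqP nc [e1 e2] [fE gE hE]]]]]].
have ef : is_even sigma f by move=> x; rewrite /star !fE [c1 _]e1 [c2 _]e2.
split.
- move=> x y; rewrite !hE !gE !fE M1 M2 [c1 (sigma _)]e1 [c2 (sigma _)]e2.
  by field; rewrite nc.
- apply: (@lin_dependent_of_odd _ _ l) => x.
  by rewrite !hE !fE [c1 (sigma _)]e1 [c2 (sigma _)]e2; field; rewrite nc.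
- apply: nonzero_on_productsP => H; apply: n12 => x.
  have H' y z : c1 (y * z)%g = c2 (y * z)%g.
    have e := H y z; rewrite even_part_id // fE in e.
    by apply: (eq_of_sub_eq (congr1 ( *%R (2 * c)) e)); field; rewrite nc.
  have := H' x x; have := H' x (x * x)%g; rewrite !M1 !M2 => e3 e2'.
  have [z|nz] := eqVneq (c1 x) 0.
    by move/eqP: e2'; rewrite z mul0r eq_sym mulf_eq0 orbb => /eqP.
  by apply: (mulIf (mulf_neq0 nz nz)); rewrite e3 -e2'.
Qed.

Lemma form_C_solves f g h : form_C sigma f g h -> conclusion f g h.
Proof.
move=> [chi [phi [l [[cM nc] [pM np] [ec ep] [fE gE hE]]]]].
have ef : is_even sigma f by move=> x; rewrite /star !fE [phi _]ep.
have [z nz] := not_zero_funP nc.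
have n2 : (2 : R[i]) != 0 by rewrite pnatr_eq0.
split.
- move=> x y; rewrite !hE !gE !fE pM [phi (sigma _)]ep [chi (sigma _)]ec.
  by field.
- by apply: (@lin_dependent_of_odd _ _ l) => x; rewrite !hE !fE; ring.
- apply: nonzero_on_productsP => H; apply: np => x.
  have H' s t : phi s * chi t + chi s * phi t = 0.
    by have := H s t; rewrite even_part_id // fE pM.
  have pz : phi z = 0.
    apply: (mulfI nz); apply: (mulfI n2).
    by apply: (eq_of_sub_eq (H' z z)); ring.
  apply: (mulfI nz); apply: (eq_of_sub_eq (H' z x)).
  by rewrite pz /zero_fun; ring.
Qed.

Lemma form_D_solves f g h : form_D sigma f g h -> conclusion f g h.
Proof.
move=> [chi [phi [psi [l [cM [pM np] sM [es ec op] [fE gE hE]]]]]].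
have ef : is_even sigma f by move=> x; rewrite /star !fE [psi _]es.
split.
- move=> x y; rewrite !hE !gE !fE sM [psi (sigma _)]es [chi (sigma _)]ec.
  rewrite [phi (sigma _)]op.
  apply: (eq_of_sub_eq (congr1 ( *%R (- (phi x * phi y))) (@sqrCi R[i]))).
  by field.
- apply: (@lin_dependent_of_odd _ _ l) => x.
  by rewrite !hE !fE [psi (sigma _)]es [phi (sigma _)]op; ring.
- apply: nonzero_on_productsP => H; apply: np => x.
  have H' s t : psi (s * t)%g = 0.
    by have := H s t; rewrite even_part_id // fE.
  (* the law at (x, x) reads phi x ^+ 2 = 0 as soon as psi x * chi x = 0; the
     law at (x, x x), split by parity, gives psi x * chi x ^+ 2 = 0 *)
  suff hp : psi x * chi x = 0.
    have /eqP : phi x * phi x = 0.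
      have := H' x x; rewrite sM => e.
      by apply: (eq_of_sub_eq (congr2 +%R e (congr1 ( *%R (-2)) hp))); ring.
    by rewrite mulf_eq0 orbb => /eqP.
  have [->|nz] := eqVneq (chi x) 0; first by rewrite mulr0.
  have [/eqP + _] := even_odd_split (sigma := sigma)
    (u := fun t => psi t * (chi x * chi x))
    (v := fun t => phi t * (2 * phi x * chi x))
    (fun t => congr1 ( *%R^~ _) (es t))
    (fun t => etrans (congr1 ( *%R^~ _) (op t)) (mulNr _ _))
    (fun t => ltac:(apply: (eq_of_sub_eq (H' t (x * x)%g));
                    rewrite sM H' cM pM; ring)) x.
  by rewrite !mulf_eq0 (negPf nz) !orbF => /eqP ->; rewrite mul0r.
Qed.

Lemma form_E_solves f g h : form_E sigma f g h -> conclusion f g h.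
Proof.
move=> [chi [c1 [l [c]]]] /=.
rewrite /star => -[[cM M1] /eqP nc [ec _ n1] [fE gE hE]].
have n2 : (2 : R[i]) != 0 by rewrite pnatr_eq0.
have ss x : c1 (sigma (sigma x)) = c1 x by rewrite sigma_inv.
have ef : is_even sigma f.
  by move=> x; rewrite /star !fE [chi (sigma _)]ec ss; ring.
split.
- move=> x y; rewrite !hE !gE !fE !gmulfM !sigma_inv !M1 cM [chi (sigma _)]ec.
  by field.
- apply: (@lin_dependent_of_odd _ _ l) => x.
  by rewrite !hE !fE [chi (sigma _)]ec ss; ring.
- apply: nonzero_on_productsP => H; apply: n1.
  apply: (even_of_products (chi := chi)) => // x y.
  have e := H x y; rewrite even_part_id // fE in e.
  apply: (mulfI n2); apply: (mulfI (mulf_neq0 nc nc)).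
  by apply: (eq_of_sub_eq (esym e)); rewrite /star; ring.
Qed.

Lemma form_F_solves f g h : form_F sigma f g h -> conclusion f g h.
Proof.
move=> [phi [psi [k [l [[pM np] sM [kM ok] [es op] [fE gE hE]]]]]].
have k2 x y : k (x * y)%g = 0 by rewrite kM /zero_fun; ring.
have s2 x y : psi (x * y)%g = phi x * phi y by rewrite sM /zero_fun; ring.
split.
- move=> x y; rewrite !hE !gE !fE s2 k2 [phi (sigma _)]op.
  apply: (eq_of_sub_eq (congr1 ( *%R (- (phi x * phi y))) (@sqrCi R[i]))).
  by field.
- apply: (@lin_dependent_of_odd _ _ l) => x.
  by rewrite !hE !fE [psi (sigma _)]es [phi (sigma _)]op [k (sigma _)]ok; ring.
- have [z nz] := not_zero_funP np; exists z, z; apply/eqP.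
  have -> : even_part sigma f (z * z)%g = phi z * phi z.
    rewrite /even_part /star !fE [psi (sigma _)]es [k (sigma _)]ok s2 k2.
    by field.
  by rewrite mulf_eq0 negb_or nz.
Qed.

End Converse.

Theorem theorem4p2 (R : realType) (S : semigroupType)
    (sigma : {multiplicative S -> S}) (sigma_inv : involutive sigma)
    (f g h : S -> R[i]) :
  [/\ solves sigma f g h,
      lin_dependent (even_part sigma h) (even_part sigma f)
    & nonzero_on_products (even_part sigma f)]
  <->
  form_A sigma f g h \/ form_B sigma f g h \/ form_C sigma f g h \/
  form_D sigma f g h \/ form_E sigma f g h \/ form_F sigma f g h.
Proof.
split=> [[sol dep nu]|]; first exact: solution_forms.
case=> [|[|[|[|[|]]]]].
- exact: form_A_solves.
- exact: form_B_solves.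
- exact: form_C_solves.
- exact: form_D_solves.
- exact: form_E_solves.
- exact: form_F_solves.
Qed.
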